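(* There exist a nonatomic probability space $(\Omega,\Sigma,\mathbb{P})$ and a convex bounded set $\mathcal{K}$ in $\mathbb{L}^1_+(\mathbb{P})$ such that the $\mathbb{L}^0(\mathbb{P})$-topology on $\mathcal{K}$ is locally convex, but there does not exist a probability measure $\mathbb{Q}\sim\mathbb{P}$ such that the $\mathbb{L}^0(\mathbb{Q})$- and $\mathbb{L}^1(\mathbb{Q})$-topologies agree on $\mathcal{K}$.
   Context: $\mathbb{L}^0(\mathbb{P})$ is the space of all real random variables on $(\Omega,\Sigma)$ modulo a.s. equality; the $\mathbb{L}^0(\mathbb{P})$-topology is the topology of convergence in probability. $\mathbb{L}^1_+(\mathbb{P})$ is the set of a.s. nonnegative elements of $\mathbb{L}^1(\mathbb{P})$; bounded means $\sup_{X\in\mathcal{K}}\mathbb{E}_{\mathbb{P}}[|X|]<\infty$. The (relative) $\mathbb{L}^0(\mathbb{P})$-topology on a convex set $\mathcal{K}$ is locally convex at $X\in\mathcal{K}$ if for every $\mathbb{L}^0(\mathbb{P})$-neighborhood $\mathcal{U}$ of $0$ there is a convex neighborhood $\mathcal{W}$ of $X$ in the relative $\mathbb{L}^0(\mathbb{P})$-topology on $\mathcal{K}$ with $\mathcal{W}\subset (X+\mathcal{U})\cap\mathcal{K}$; it is locally convex on $\mathcal{K}$ if this holds at every $X\in\mathcal{K}$. $\mathbb{Q}\sim\mathbb{P}$ means that $\mathbb{Q}$ is a probability measure on $(\Omega,\Sigma)$ mutually absolutely continuous with $\mathbb{P}$. That the $\mathbb{L}^0(\mathbb{Q})$- and $\mathbb{L}^1(\mathbb{Q})$-topologies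 agree on $\mathcal{K}$ means that $\mathcal{K}\subseteq\mathbb{L}^1(\mathbb{Q})$ and the relative topologies on $\mathcal{K}$ inherited from $\mathbb{L}^0(\mathbb{Q})$ and from the norm of $\mathbb{L}^1(\mathbb{Q})$ coincide. *)

(* Defs.v *)
From HB Require Import structures.
From mathcomp Require Import all_boot all_order all_algebra.
From mathcomp Require Import all_classical all_reals all_analysis.
From mathcomp Require Import measurable_realfun.

Set Implicit Arguments.
Unset Strict Implicit.
Unset Printing Implicit Defensive.
Import Order.TTheory GRing.Theory Num.Theory.
Import numFieldNormedType.Exports.
Local Open Scope classical_set_scope.
Local Open Scope ring_scope.

Definition nonatomic d (T : measurableType d) (R : realType)
    (P : probability T R) :=
  forall A : set T, measurable A -> (0 < P A)%E ->
    exists B : set T, [/\ measurable B, B `<=` A & (0 < P B < P A)%E].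

Definition equivalent_measure d (T : measurableType d) (R : realType)
    (Q P : probability T R) :=
  Q `<< P /\ P `<< Q.

Definition L0 d (T : measurableType d) (R : realType) (P : probability T R)
  : Type := {mfun_ P, T >-> R}.

Section L0_vector_space.
Context d (T : measurableType d) (R : realType) (P : probability T R).
Local Open Scope quotient_scope.

HB.instance Definition _ := Choice.on (L0 P).
HB.instance Definition _ := EqQuotient.on (L0 P).

Definition L0_fun (X : L0 P) : {mfun T >-> R} := repr X.
Coercion L0_fun : L0 >-> MeasurableFun.type.

Definition L0_class (f : {mfun T >-> R}) : L0 P := \pi f.

Lemma L0_classP (f : {mfun T >-> R}) :
  (L0_class f : T -> R) = (f : T -> R) %[ae P].
Proof.
have /eqmodP/asboolP : L0_fun (L0_class f) = f %[mod L0 P].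
  by rewrite /L0_fun reprK.
by [].
Qed.

Lemma L0_eqP (X Y : L0 P) : X = Y <-> (X : T -> R) = (Y : T -> R) %[ae P].
Proof.
split=> [->|XY]; first exact: ae_eq_refl.
have : \pi_(L0 P) (repr X) = \pi_(L0 P) (repr Y) by apply/eqmodP/asboolP.
by rewrite !reprK.
Qed.

Let add (X Y : L0 P) : L0 P :=
  L0_class ((X : {mfun T >-> R}) + (Y : {mfun T >-> R})).
Let opp (X : L0 P) : L0 P := L0_class (- (X : {mfun T >-> R})).
Let scale (a : R) (X : L0 P) : L0 P := L0_class (a *: (X : {mfun T >-> R})).

Let addE X Y : (add X Y : T -> R) = (fun w => X w + Y w) %[ae P].
Proof. exact: L0_classP. Qed.

Let oppE X : (opp X : T -> R) = (fun w => - X w) %[ae P].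
Proof. exact: L0_classP. Qed.

Let scaleE a X : (scale a X : T -> R) = (fun w => a * X w) %[ae P].
Proof. exact: L0_classP. Qed.

Let zeroE : (L0_class 0 : T -> R) = (fun=> 0) %[ae P].
Proof. exact: L0_classP. Qed.

Let addA : associative add.
Proof.
move=> X Y Z; apply/L0_eqP; near=> w => _.
rewrite (near (addE X (add Y Z)) w)// (near (addE Y Z) w)//.
by rewrite (near (addE (add X Y) Z) w)// (near (addE X Y) w)// addrA.
Unshelve. all: by end_near. Qed.

Let addC : commutative add.
Proof.
move=> X Y; apply/L0_eqP; near=> w => _.
by rewrite (near (addE X Y) w)// (near (addE Y X) w)// addrC.
Unshelve. all: by end_near. Qed.

Let add0 : left_id (L0_class 0) add.
Proof.
move=> X; apply/L0_eqP; near=> w => _.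
by rewrite (near (addE (L0_class 0) X) w)// (near zeroE w)// add0r.
Unshelve. all: by end_near. Qed.

Let addN : left_inverse (L0_class 0) opp add.
Proof.
move=> X; apply/L0_eqP; near=> w => _.
rewrite (near (addE (opp X) X) w)// (near (oppE X) w)// (near zeroE w)//.
by rewrite addNr.
Unshelve. all: by end_near. Qed.

HB.instance Definition _ := GRing.isZmodule.Build (L0 P) addA addC add0 addN.

Let scaleA a b X : scale a (scale b X) = scale (a * b) X.
Proof.
apply/L0_eqP; near=> w => _.
rewrite (near (scaleE a (scale b X)) w)// (near (scaleE b X) w)//.
by rewrite (near (scaleE (a * b) X) w)// mulrA.
Unshelve. all: by end_near. Qed.

Let scale1 : left_id 1 scale.
Proof.
move=> X; apply/L0_eqP; near=> w => _.
by rewrite (near (scaleE 1 X) w)// mul1r.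
Unshelve. all: by end_near. Qed.

Let scaleDr : right_distributive scale +%R.
Proof.
move=> a X Y; apply/L0_eqP; near=> w => _.
rewrite (near (scaleE a (X + Y)) w)// (near (addE X Y) w)//.
rewrite (near (addE (scale a X) (scale a Y)) w)//.
by rewrite (near (scaleE a X) w)// (near (scaleE a Y) w)// mulrDr.
Unshelve. all: by end_near. Qed.

Let scaleDl X : {morph scale^~ X : a b / a + b}.
Proof.
move=> a b; apply/L0_eqP; near=> w => _.
rewrite (near (scaleE (a + b) X) w)//.
rewrite (near (addE (scale a X) (scale b X)) w)//.
by rewrite (near (scaleE a X) w)// (near (scaleE b X) w)// mulrDl.
Unshelve. all: by end_near. Qed.

HB.instance Definition _ := GRing.Zmodule_isLmodule.Build R (L0 P)
  scaleA scale1 scaleDr scaleDl.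

Lemma L0D (X Y : L0 P) :
  ((X + Y : L0 P) : T -> R) = (fun w => X w + Y w) %[ae P].
Proof. exact: addE. Qed.

Lemma L0N (X : L0 P) : ((- X : L0 P) : T -> R) = (fun w => - X w) %[ae P].
Proof. exact: oppE. Qed.

Lemma L0Z (a : R) (X : L0 P) :
  ((a *: X : L0 P) : T -> R) = (fun w => a * X w) %[ae P].
Proof. exact: scaleE. Qed.

Lemma L00 : ((0 : L0 P) : T -> R) = (fun=> 0) %[ae P].
Proof. exact: zeroE. Qed.

End L0_vector_space.

(* The topology of convergence in probability, as the pseudometric (Ky Fan)
   topology in which Y lies in the ball of centre X and radius e iff
   P(|X - Y| >= e) < e; see cvg_L0P. *)
Section L0_topology.
Context d (T : measurableType d) (R : realType) (P : probability T R).

Definition deviation (X Y : T -> R) (e : R) : set T :=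
  [set w | e <= `|X w - Y w|].

Lemma measurable_deviation (X Y : {mfun T >-> R}) e :
  measurable (deviation X Y e).
Proof.
have mXY : measurable_fun setT (fun w => `|X w - Y w|).
  by apply: measurableT_comp => //; exact: measurable_funB.
rewrite (_ : deviation _ _ _ = (fun w => `|X w - Y w|) @^-1` `[e, +oo[).
  by rewrite -[X in measurable X]setTI; exact: mXY.
by apply/seteqP; split => w /=; rewrite in_itv/= andbT.
Qed.

Definition L0_ball (X : L0 P) (e : R) (Y : L0 P) : Prop :=
  (P (deviation X Y e) < e%:E)%E.

Let ball_center (X : L0 P) (e : R) : 0 < e -> L0_ball X e X.
Proof.
move=> e0; rewrite /L0_ball (_ : deviation _ _ _ = set0) ?measure0 ?lte_fin//.
by apply/seteqP; split => w //=; rewrite /deviation/= subrr normr0 leNgt e0.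
Qed.

Let ball_sym (X Y : L0 P) (e : R) : L0_ball X e Y -> L0_ball Y e X.
Proof.
rewrite /L0_ball (_ : deviation X Y e = deviation Y X e)//.
by apply/seteqP; split => w; rewrite /deviation/= distrC.
Qed.

Let ball_triangle (X Y Z : L0 P) (e1 e2 : R) :
  L0_ball X e1 Y -> L0_ball Y e2 Z -> L0_ball X (e1 + e2) Z.
Proof.
move=> XY YZ.
have sub : deviation X Z (e1 + e2) `<=` deviation X Y e1 `|` deviation Y Z e2.
  move=> w; rewrite /deviation/= => XZ; apply/orP; rewrite !leNgt -negb_and.
  apply/negP => /andP[XYw YZw]; move: XZ; rewrite leNgt => /negP; apply.
  by rewrite (le_lt_trans (ler_distD (Y w) _ _))// ltrD.
have mU : measurable (deviation X Y e1 `|` deviation Y Z e2).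
  by apply: measurableU; exact: measurable_deviation.
rewrite /L0_ball EFinD (@le_lt_trans _ _
  (P (deviation X Y e1) + P (deviation Y Z e2))%E)//; last exact: lteD.
rewrite (le_trans (le_measure _ _ _ sub))//.
- by rewrite inE; exact: measurable_deviation.
- by rewrite inE.
- by apply: measureU2; exact: measurable_deviation.
Qed.

HB.instance Definition _ := hasNbhs.Build (L0 P)
  (nbhs_ (entourage_ L0_ball)).
HB.instance Definition _ := @Nbhs_isPseudoMetric.Build R (L0 P)
  (entourage_ L0_ball) erefl L0_ball ball_center ball_sym ball_triangle erefl.

Lemma cvg_L0P (u : (L0 P)^nat) (X : L0 P) :
  (u @ \oo --> X) <->
  (forall e, 0 < e -> P (deviation X (u n) e) @[n --> \oo] --> 0%E).
Proof.
have fP n e : P (deviation X (u n) e) \is a fin_num.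
  by apply: fin_num_measure; exact: measurable_deviation.
split=> [/cvg_ballP uX e e0|uX].
- apply/fine_cvgP; split; first exact: nearW.
  apply/cvgrPdist_lt => r r0; have m0 : 0 < Num.min e r by rewrite lt_min e0.
  apply: filterS (uX _ m0) => n; rewrite /ball/= /L0_ball => unX.
  rewrite sub0r normrN ger0_norm ?fine_ge0// -lte_fin fineK//.
  rewrite (@le_lt_trans _ _ (P (deviation X (u n) (Num.min e r))))//.
    apply: le_measure; rewrite ?inE; [exact: measurable_deviation..|].
    by move=> w; rewrite /deviation/=; apply: le_trans; rewrite ge_min lexx.
  by rewrite (lt_le_trans unX)// lee_fin ge_min lexx orbT.
- apply/cvg_ballP => e e0; have /fine_cvgP[_ /cvgrPdist_lt] := uX e e0.
  move=> /(_ e e0); apply: filterS => n /=.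
  by rewrite sub0r normrN ger0_norm ?fine_ge0// -lte_fin fineK.
Qed.

End L0_topology.

(* The library's LspaceType1 has no vector space or topological structure, so
   the normed space is built here as a subspace of L0. *)
Section L1_normed_space.
Context d (T : measurableType d) (R : realType) (P : probability T R).

Definition L1_pred : {pred L0 P} :=
  mem [set X : L0 P | (X : T -> R) \in Lfun P 1].

Record L1 : Type := MkL1 { L1_val :> L0 P ; L1_valP : L1_val \in L1_pred }.
HB.instance Definition _ := [isSub of L1 for L1_val].
HB.instance Definition _ := [Choice of L1 by <:].

Let Lnorm_ae (f g : {mfun T >-> R}) : (f : T -> R) = (g : T -> R) %[ae P] ->
  ('N[P]_1[EFin \o f] = 'N[P]_1[EFin \o g])%E.
Proof.
move=> fg; rewrite !Lnorm1; apply: ae_eq_integral => //=.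
- by do 2 apply: measurableT_comp => //.
- by do 2 apply: measurableT_comp => //.
- by apply: filterS fg => w /= /[apply] ->.
Qed.

Let Lfun_ae (f g : {mfun T >-> R}) : (f : T -> R) = (g : T -> R) %[ae P] ->
  (f : T -> R) \in Lfun P 1 -> (g : T -> R) \in Lfun P 1.
Proof.
move=> fg /andP[_]; rewrite inE/= => ff; apply/andP; split; first exact: mfunP.
by rewrite inE/= /finite_norm -(Lnorm_ae fg).
Qed.

Let ae_sym (f g : T -> R) : f = g %[ae P] -> g = f %[ae P].
Proof. exact: ae_eq_sym. Qed.

Let L1_submod : submod_closed L1_pred.
Proof.
have [z l] := @Lfun_submod_closed _ _ _ P _ (@lexx _ _ 1%E).
split=> [|a X Y]; rewrite !inE/=.
  exact: (Lfun_ae (f := 0) (ae_sym (L00 P))).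
move=> X1 Y1; apply: (@Lfun_ae (a *: L0_fun X + L0_fun Y) (L0_fun (a *: X + Y))); last first.
  exact: l.
  apply: ae_sym; near=> w => _.
  by rewrite (near (L0D (a *: X) Y) w)// (near (L0Z a X) w).
Unshelve. all: by end_near. Qed.

HB.instance Definition _ := GRing.isSubmodClosed.Build R (L0 P) L1_pred
  L1_submod.
HB.instance Definition _ := [SubChoice_isSubLmodule of L1 by <:].

Let N1 (X : L1) : R := fine ('N[P]_1[EFin \o (X : T -> R)])%E.

Let L1_Lfun (X : L1) : (X : T -> R) \in Lfun P 1.
Proof. by have := L1_valP X; rewrite inE. Qed.

Let N1E (X : L1) : (N1 X)%:E = ('N[P]_1[EFin \o (X : T -> R)])%E.
Proof.
rewrite /N1 fineK// ge0_fin_numE ?Lnorm_ge0//.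
by have /andP[_] := L1_Lfun X; rewrite inE.
Qed.

Let ler_N1D (X Y : L1) : N1 (X + Y) <= N1 X + N1 Y.
Proof.
rewrite -lee_fin EFinD !N1E.
rewrite (Lnorm_ae (g := (X : {mfun T >-> R}) + (Y : {mfun T >-> R}))).
  by apply: eminkowski.
exact: L0D.
Qed.

Let N1Z (a : R) (X : L1) : N1 (a *: X) = `|a| * N1 X.
Proof.
apply: EFin_inj; rewrite EFinM !N1E.
rewrite (Lnorm_ae (g := a *: (X : {mfun T >-> R}))); last exact: L0Z.
exact: (LnormZ (Lfun_Sub (@lexx _ _ 1%E) (L1_Lfun X)) a).
Qed.

Let N1_eq0 (X : L1) : N1 X = 0 -> X = 0.
Proof.
move=> X0; apply/val_inj/L0_eqP.
have : ('N[P]_1[EFin \o (X : T -> R)])%E = 0%E by rewrite -N1E X0.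
move=> /Lnorm_eq0_eq0 XP.
have {}XP : (EFin \o (X : T -> R)) = \0%E %[ae P].
  by apply: XP => //; exact/measurable_EFinP.
near=> w => _; rewrite (near (L00 P) w)//; apply: EFin_inj.
exact: (near XP w).
Unshelve. all: by end_near. Qed.

HB.instance Definition _ := Lmodule_isNormed.Build R L1 ler_N1D N1Z N1_eq0.

Lemma L1_normE (X : L1) : `|X| = fine ('N[P]_1[EFin \o (X : T -> R)])%E.
Proof. by []. Qed.

End L1_normed_space.

Definition L1plus d (T : measurableType d) (R : realType)
    (P : probability T R) : set (L0 P) :=
  [set X : L0 P | (X : T -> R) \in Lfun P 1 /\ {ae P, forall w, 0 <= X w}].

Arguments L1plus {d T R} P _.

Definition L1_bounded d (T : measurableType d) (R : realType)
    (P : probability T R) (K : set (L0 P)) :=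
  (ereal_sup [set 'E_P[fun w => `|X w|%R] | X in K] < +oo)%E.

Definition L0_locally_convex_at d (T : measurableType d) (R : realType)
    (P : probability T R) (K : set (L0 P)) (X : L0 P) :=
  forall U : set (L0 P), nbhs 0 U ->
    exists W : set (L0 P),
      [/\ within K (nbhs X) W,
          convex_set (W : set (convex_lmodType (L0 P))) &
          W `<=` [set X + V | V in U] `&` K].

Definition L0_locally_convex d (T : measurableType d) (R : realType)
    (P : probability T R) (K : set (L0 P)) :=
  forall X, K X -> L0_locally_convex_at K X.

(* The image in L0 Q of a class modulo P; for Q equivalent to P this is the
   usual identification of L0 P with L0 Q. *)
Definition L0_transport d (T : measurableType d) (R : realType)
    (P Q : probability T R) (X : L0 P) : L0 Q := L0_class Q X.
Arguments L0_transport {d T R P} Q X.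

(* Both relative topologies are compared as families of subsets A of K; a set
   open in L1 Q is viewed in L0 Q through the inclusion L1_val. *)
Definition L0_L1_topologies_agree d (T : measurableType d) (R : realType)
    (Q : probability T R) (K : set (L0 Q)) :=
  K `<=` [set X : L0 Q | (X : T -> R) \in Lfun Q 1] /\
  forall A : set (L0 Q),
    (exists2 O : set (L0 Q), open O & A = K `&` O) <->
    (exists2 O : set (L1 Q), open O & A = K `&` (@L1_val _ _ _ Q @` O)).

(* Main.v *)
(** Let u be a [0, 1)-valued random variable with diffuse law and (k = j), for
    j >= 0, events of positive probability; the base is (k = 0).  A
    subprobability mu on [0, 1] that is the sum of finitely many atoms and of
    the image under u of f.P restricted to the base is encoded as the random
    variable X equal to f on the base and to the j-th normalised moment of mu on
    (k = j + 1).  The set K of all these X is convex.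

    Local convexity at X: let g >= 0 be the polynomial vanishing exactly at the
    atoms of X.  If Y in K tends to X in probability, the moments of Y converge,
    so limsup E[g(u) Y; base] <= E[g(u) X; base], since g does not see the atoms
    of X.  Together with E[(X - Y)^+] -> 0 this gives convergence in the norm of
    L1(g(u) P), whose balls are convex.

    No common Q: each Dirac mass at a in [0, 1] is encoded by a point of K which
    vanishes on the base and is the limit in probability of normalised
    indicators of {u in I_n} with I_n shrinking to a.  These are not small in
    L1(Q) when Q(u in I_n) >= c P(u in I_n) on the base, which holds for some a
    by bisection. *)

Require Import Defs.
From HB Require Import structures.
From mathcomp Require Import all_boot all_order all_algebra.
From mathcomp Require Import all_classical all_reals all_analysis.
From mathcomp Require Import measurable_realfun.
From mathcomp Require Import ring lra.

Set Implicit Arguments.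
Unset Strict Implicit.
Unset Printing Implicit Defensive.
Import Order.TTheory GRing.Theory Num.Theory.
Import numFieldNormedType.Exports.
Local Open Scope classical_set_scope.
Local Open Scope ring_scope.

(** Halving forever gives nested intervals of length 2^-n that shrink to the supremum of their left
    ends. This localises at a point any property that an interval always passes on to one of its
    halves. *)
Lemma bisection (R : realType) (G : R -> R -> Prop) :
  (forall a b, a < b -> G a b -> G a ((a + b) / 2) \/ G ((a + b) / 2) b) ->
  G 0 1 ->
  exists2 c : R, 0 <= c <= 1 & forall e : R, 0 < e ->
    exists a b : R, [/\ 0 <= a, b <= 1, a <= c <= b, b - a < e & G a b].
Proof.
(* The intervals are carried with their invariants in a sigma type, so that the chosen half can be
   iterated as a function. *)
move=> halve G01.
pose good (I : R * R) := [/\ 0 <= I.1, I.2 <= 1, I.1 < I.2 & G I.1 I.2].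
have step (I : {I | good I}) : {J : {J | good J} |
    [/\ (sval I).1 <= (sval J).1, (sval J).2 <= (sval I).2 &
        (sval J).2 - (sval J).1 = ((sval I).2 - (sval I).1) / 2]}.
  apply/cid; case: I => -[a b] [/= a0 b1 ab /(halve _ _ ab)[Gl|Gr]].
  - suff g : good (a, (a + b) / 2) by exists (exist _ _ g); split => /=; lra.
    by split => //=; lra.
  - suff g : good ((a + b) / 2, b) by exists (exist _ _ g); split => /=; lra.
    by split => //=; lra.
have good01 : good (0, 1) by split => /=.
pose I n := iter n (fun J => sval (step J)) (exist _ _ good01).
pose a n := (sval (I n)).1; pose b n := (sval (I n)).2.
have aS n : a n <= a n.+1 by rewrite /a /=; case: (svalP (step (I n))).
have bS n : b n.+1 <= b n by rewrite /b /=; case: (svalP (step (I n))).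
have width n : b n - a n = 2^-1 ^+ n.
  elim: n => [|n ih]; first by rewrite /b/a/= subr0 expr0.
  by rewrite exprS -ih mulrC /b/a/=; case: (svalP (step (I n))).
have goodI n : [/\ 0 <= a n, b n <= 1, a n < b n & G (a n) (b n)].
  by rewrite /a/b; case: (svalP (I n)).
have a_nd : nondecreasing_seq a by apply/nondecreasing_seqP.
have b_ni : nonincreasing_seq b by apply/nonincreasing_seqP.
have a_le_b m n : a m <= b n.
  have [mn|/ltnW nm] := leqP m n.
    by have [_ _ /ltW h _] := goodI n; exact: le_trans (a_nd _ _ mn) h.
  by have [_ _ /ltW h _] := goodI m; exact: le_trans h (b_ni _ _ nm).
have supA : has_sup (range a).
  by split; [exists (a 0%N), 0%N | exists (b 0%N) => _ [n _ <-]].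
have ac n : a n <= sup (range a) by apply: ub_le_sup; [case: supA|exists n].
have cb n : sup (range a) <= b n.
  by apply: ge_sup => [|_ [m _ <-]//]; case: supA.
exists (sup (range a)).
  by rewrite (le_trans _ (ac 0%N))// (le_trans (cb 0%N))//; case: (goodI 0%N).
move=> e e0.
have : 2^-1 ^+ n @[n --> \oo] --> (0 : R).
  by apply: cvg_expr; rewrite ger0_norm; lra.
move=> /cvgrPdist_lt/(_ e e0)[n _ /(_ n (leqnn n))] /=.
rewrite sub0r normrN -width => wn; exists (a n), (b n).
have [a0 b1 ab Gab] := goodI n; rewrite ac cb; split => //.
exact: le_lt_trans (ler_norm _) wn.
Qed.

(** * Probability spaces *)

Section measure_lemmas.
Context d (T : measurableType d) (R : realType) (P : probability T R).
Local Notation integrable f := (P.-integrable setT (EFin \o f)).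

Lemma measurable_near (v : T -> R) (a e : R) :
  measurable_fun setT v -> measurable [set t | `|v t - a| <= e].
Proof.
move=> mv; rewrite -[X in measurable X]setTI.
rewrite (_ : [set t | _] = (fun t => `|v t - a|) @^-1` `]-oo, e]); last first.
  by apply/seteqP; split => t /=; rewrite in_itv/=.
have : measurable_fun setT (fun t => `|v t - a|).
  by apply: measurableT_comp => //; exact: measurable_funB.
by apply.
Qed.

(** Continuity from above along the radii 1 / (n + 1). It serves for a diffuse variable at any
    level, and for a weight that is almost surely nonzero at the level 0. *)
Lemma small_ball (v : T -> R) (a e : R) : measurable_fun setT v ->
  P [set t | v t = a] = 0%E -> 0 < e ->
  exists2 r : R, 0 < r & (P [set t | (`|v t - a| <= r)%R] < e%:E)%E.
Proof.
move=> mv va0 e0; pose F n := [set t | `|v t - a| <= n.+1%:R^-1].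
have mF n : measurable (F n) by exact: measurable_near.
have capF : \bigcap_n F n = [set t | v t = a].
  apply/seteqP; split => t /=; last first.
    by move=> vta n _; rewrite /F/= vta subrr normr0.
  move=> Ft; apply/eqP; rewrite -subr_eq0 -normr_eq0 eq_le normr_ge0 andbT.
  apply/ler_addgt0Pl => x x0; rewrite addr0.
  have [n _ /(_ n (leqnn n)) /=] := near_infty_natSinv_lt (PosNum x0).
  by move=> /ltW; apply: le_trans; exact: (Ft n).
have : P (F n) @[n --> \oo] --> 0%E.
  rewrite -va0 -capF; apply: nonincreasing_cvg_mu => //.
  - exact: le_lt_trans (probability_le1 _ _) (ltry _).
  - exact: bigcap_measurable.
  - move=> m n mn; apply/subsetPset => t; rewrite /F/= => /le_trans; apply.
    by rewrite lef_pV2 ?posrE// ler_nat.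
have PF n : P (F n) \is a fin_num by exact: fin_num_measure.
move=> /fine_cvgP[_ /cvgrPdist_lt/(_ e e0)[n _ /(_ n (leqnn n))]] /=.
rewrite sub0r normrN ger0_norm ?fine_ge0// => Fe; exists n.+1%:R^-1 => //.
by have : (P (F n) < e%:E)%E by rewrite -(fineK (PF n)) lte_fin.
Qed.

Lemma ae_eq_Rintegral (f g : T -> R) : measurable_fun setT f ->
  measurable_fun setT g -> {ae P, forall t, f t = g t} ->
  \int[P]_t f t = \int[P]_t g t.
Proof.
move=> mf mg fg; congr fine; apply: ae_eq_integral => //.
- exact/measurable_EFinP.
- exact/measurable_EFinP.
- by apply: filterS fg => t /= ->.
Qed.

Lemma ae_le_measure (A B : set T) : measurable A -> measurable B ->
  {ae P, forall t, A t -> B t} -> (P A <= P B)%E.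
Proof.
move=> mA mB [N [mN N0 AB]]; have <- : P (B `|` N) = P B.
  by move/(measure0_null_setP _ mN)/(null_setU _ mN) : N0; exact.
apply: le_measure; rewrite ?inE//; first exact: measurableU.
move=> t At; have [Bt|nBt] := pselect (B t); [by left|right].
by apply: AB => /(_ At).
Qed.

Lemma integrable_measurable (f : T -> R) :
  integrable f -> measurable_fun setT f.
Proof. by move=> /measurable_int/measurable_EFinP. Qed.

Lemma ae_eq_integrable (f g : T -> R) : integrable f ->
  measurable_fun setT g -> {ae P, forall t, f t = g t} -> integrable g.
Proof.
move=> fi mg fg; have mf := integrable_measurable fi.
move/integrableP : fi => [_ fi]; apply/integrableP; split.
  exact/measurable_EFinP.
rewrite (_ : integral _ _ _ = \int[P]_t `|(f t)%:E|)%E//.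
apply: ae_eq_integral => //.
- by apply/measurable_EFinP; exact: measurableT_comp.
- by apply/measurable_EFinP; exact: measurableT_comp.
- by apply: filterS fg => t ->.
Qed.

Lemma Rintegrable_add (f g : T -> R) : integrable f -> integrable g ->
  integrable (fun t => f t + g t).
Proof. exact: integrableD. Qed.

Lemma Rintegrable_sub (f g : T -> R) : integrable f -> integrable g ->
  integrable (fun t => f t - g t).
Proof. by move=> fi gi; exact: (integrableB _ fi gi). Qed.

Lemma Rintegrable_scale (c : R) (f : T -> R) : integrable f ->
  integrable (fun t => c * f t).
Proof. by move=> fi; exact: (integrableZl _ c fi). Qed.

Lemma integrable_bounded (h : T -> R) (c : R) : measurable_fun setT h ->
  (forall t, `|h t| <= c) -> integrable h.
Proof.
move=> mh hc; apply: measurable_bounded_integrable => //.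
  exact: le_lt_trans (probability_le1 _ _) (ltry _).
exists c; split; first exact: num_real.
by move=> x cx t _; exact: le_trans (hc t) (ltW cx).
Qed.

Lemma integrable_bounded_mul (h f : T -> R) (c : R) : measurable_fun setT h ->
  (forall t, `|h t| <= c) -> integrable f -> integrable (fun t => h t * f t).
Proof.
move=> mh hc fi; have mf := integrable_measurable fi.
apply: (@le_integrable _ _ _ P setT _ _ (EFin \o (fun t => c * `|f t|))) => //.
- by apply/measurable_EFinP; exact: measurable_funM.
- move=> t _; rewrite /= lee_fin normrM (le_trans _ (ler_norm _))//.
  by rewrite ler_wpM2r.
- by apply: (@Rintegrable_scale c (fun t => `|f t|)); exact: integrable_norm.
Qed.

Lemma ae_le_Rintegral (f g : T -> R) : integrable f -> integrable g ->
  {ae P, forall t, f t <= g t} -> \int[P]_t f t <= \int[P]_t g t.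
Proof.
move=> fi gi fg; rewrite -subr_ge0 -RintegralB//.
have mf := integrable_measurable fi; have mg := integrable_measurable gi.
have mgf := measurable_funB mg mf.
rewrite (@ae_eq_Rintegral _ (fun t => `|g t - f t|))//.
- exact: Rintegral_ge0.
- exact: measurableT_comp.
- by apply: filterS fg => t ?; rewrite ger0_norm// subr_ge0.
Qed.

Lemma Rintegral_indic (A : set T) : measurable A ->
  \int[P]_t (\1_A t : R) = fine (P A).
Proof. by move=> mA; rewrite /Rintegral integral_indic// setIT. Qed.

Lemma integrable_indic1 (A : set T) : measurable A ->
  integrable (\1_A : T -> R).
Proof.
move=> mA; apply: (@integrable_bounded _ 1) => //.
by move=> t; rewrite indicE; case: (_ \in _); rewrite ?normr1 ?normr0.
Qed.

Lemma integrable_indic_mul (A : set T) (f : T -> R) : measurable A ->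
  integrable f -> integrable (fun t => \1_A t * f t).
Proof.
move=> mA; apply: (@integrable_bounded_mul _ _ 1) => //.
by move=> t; rewrite indicE; case: (_ \in _); rewrite ?normr1 ?normr0.
Qed.

Lemma integrable_const (c : R) : integrable (fun _ : T => c).
Proof. by apply: (@integrable_bounded _ `|c|). Qed.

Lemma Rintegral_const (c : R) : \int[P]_t c = c.
Proof. by rewrite Rintegral_cst//= [P _]probability_setT mulr1. Qed.

Lemma fine_prob_gt0 (A : set T) : measurable A ->
  (0 < fine (P A)) = (0 < P A)%E.
Proof.
by move=> mA; rewrite -[in RHS](fineK (fin_num_measure P _ mA)) lte_fin.
Qed.

Lemma fine_prob_ge0 (A : set T) : 0 <= fine (P A).
Proof. exact: fine_ge0. Qed.

End measure_lemmas.

Lemma dominates_ae d (T : measurableType d) (R : realType)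
    (P Q : probability T R) (S : set T) :
  Q `<< P -> {ae P, forall t, S t} -> {ae Q, forall t, S t}.
Proof.
move=> /null_content_dominatesP QP [N [mN N0 SN]].
by exists N; split => //; exact: QP.
Qed.

(** * Cutting an event along the values of a random variable *)

Section slices.
Context d (T : measurableType d) (R : realType) (u : T -> R).
Hypothesis measurable_u : measurable_fun setT u.
Hypothesis u01 : forall t, 0 <= u t < 1.

Definition slice (A : set T) (a b : R) : set T := A `&` [set t | a <= u t < b].

Lemma measurable_slice A a b : measurable A -> measurable (slice A a b).
Proof.
move=> mA; apply: measurableI => //; rewrite -[X in measurable X]setTI.
rewrite (_ : [set t | _] = u @^-1` `[a, b[); first exact: measurable_u.
by apply/seteqP; split => t /=; rewrite in_itv.
Qed.

Lemma slice01 A : slice A 0 1 = A.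
Proof. by apply/seteqP; split => [t []//|t At]; split => //; exact: u01. Qed.

Lemma slice_near A a b c r : a <= c <= b -> b - a <= r ->
  slice A a b `<=` A `&` [set t | `|u t - c| <= r].
Proof.
move=> /andP[ac cb] ba t [At /= /andP[au ub]]; split => //=.
by rewrite ler_distl; apply/andP; split; lra.
Qed.

Lemma measure_slice (P : probability T R) A a m b : measurable A ->
  a <= m -> m <= b ->
  fine (P (slice A a b)) = fine (P (slice A a m)) + fine (P (slice A m b)).
Proof.
move=> mA am mb; have mS x y := measurable_slice x y mA.
rewrite -fineD ?fin_num_measure// -measureU//.
  congr (fine (P _)); rewrite -setIUr; congr (_ `&` _).
  apply/seteqP; split => t /=.
    by case: (ltP (u t) m) => um /andP[-> ->]; [left|right].
  move=> [/andP[-> /lt_le_trans]|/andP[/(le_trans am) -> ->//]].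
  exact.
apply/seteqP; split => t //= [[_ /andP[_ um]] [_ /andP[]]].
by rewrite leNgt um.
Qed.

(** Bisection finds a point c such that [A] has positive mass over arbitrarily short intervals
    around c. Since [u = c] is null, the part of [A] where [u] is close to c has mass below that of
    [A]. *)
Lemma diffuse_nonatomic (P : probability T R) :
  (forall a, P [set t | u t = a] = 0%E) -> nonatomic P.
Proof.
move=> diffuse A mA PA.
have mS a b := measurable_slice a b mA.
have [||c _ small] := @bisection R (fun a b => 0 < fine (P (slice A a b))).
- move=> a b ab; rewrite (@measure_slice P A a ((a + b) / 2) b)//; [|lra..].
  have := fine_prob_ge0 P (slice A a ((a + b) / 2)).
  rewrite le_eqVlt => /predU1P[<-|]; last by left.
  by rewrite add0r; right.
- by rewrite slice01 fine_prob_gt0.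
have PAfin := fin_num_measure P _ mA.
have /(small_ball measurable_u (diffuse c))[r r0] : 0 < fine (P A).
  by rewrite fine_prob_gt0.
rewrite fineK// => rA; have [a [b [_ _ acb bar]]] := small _ r0.
rewrite fine_prob_gt0// => Pab.
exists (A `&` [set t | `|u t - c| <= r]).
have mB : measurable (A `&` [set t | `|u t - c| <= r]).
  by apply: measurableI => //; exact: measurable_near.
split=> //; apply/andP; split.
  rewrite (lt_le_trans Pab)// le_measure ?inE//.
  by apply: slice_near => //; exact: ltW.
rewrite (le_lt_trans _ rA)// le_measure ?inE//.
exact: measurable_near.
Qed.

(* One half of an interval always has a ratio Q / P at least that of the whole,
   so bisection produces a point that plays the role of a Lebesgue point of
   dQ/dP. *)
Lemma nested_slices (P Q : probability T R) A : P `<< Q -> measurable A ->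
  (0 < P A)%E ->
  exists c alpha : R, [/\ 0 < c, 0 <= alpha <= 1 & forall e : R, 0 < e ->
    exists a b : R, [/\ a <= alpha <= b, b - a < e, (0 < Q (slice A a b))%E &
      c * fine (P (slice A a b)) <= fine (Q (slice A a b))]].
Proof.
move=> /null_content_dominatesP PQ mA PA.
have mS a b := measurable_slice a b mA.
have Q0P0 B : measurable B -> fine (Q B) = 0 -> fine (P B) = 0.
  move=> mB QB; rewrite PQ// -[LHS](fineK (fin_num_measure Q _ mB)).
  by rewrite QB.
have PA' : 0 < fine (P A) by rewrite fine_prob_gt0.
have QA : 0 < fine (Q A).
  rewrite lt_neqAle fine_prob_ge0 andbT eq_sym; apply/eqP => /(Q0P0 _ mA).
  by move=> PA0; rewrite PA0 ltxx in PA'.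
pose c := fine (Q A) / fine (P A).
have c0 : 0 < c by exact: divr_gt0.
pose G a b := 0 < fine (Q (slice A a b)) /\
  c * fine (P (slice A a b)) <= fine (Q (slice A a b)).
have [||alpha alpha01 small] := @bisection R G.
- move=> a b ab; rewrite /G.
  rewrite (@measure_slice P A a ((a + b) / 2) b)//; [|lra..].
  rewrite (@measure_slice Q A a ((a + b) / 2) b)//; [|lra..].
  set m := (a + b) / 2.
  have := Q0P0 _ (mS a m); have := Q0P0 _ (mS m b).
  have := fine_prob_ge0 P (slice A a m); have := fine_prob_ge0 P (slice A m b).
  have := fine_prob_ge0 Q (slice A a m); have := fine_prob_ge0 Q (slice A m b).
  move: (fine (P _)) (fine (P _)) (fine (Q _)) (fine (Q _)) => p1 p2 q1 q2.
  move=> q2_ge0 q1_ge0 p1_ge0 p2_ge0 q20 q10 [q12].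
  rewrite mulrDr => pq.
  have cp1 : 0 <= c * p1 by rewrite mulr_ge0// ltW.
  have cp2 : 0 <= c * p2 by rewrite mulr_ge0// ltW.
  (* A left half without [Q] mass has no [P] mass either, so the right half inherits everything.
     Otherwise, if the left half misses the ratio c, the right half exceeds it strictly, which also
     makes its [Q] mass positive. *)
  have [q1eq|q1neq] := eqVneq q1 0.
    by right; move: pq; rewrite q10// mulr0; split; lra.
  have q1gt : 0 < q1 by rewrite lt_neqAle eq_sym q1neq.
  by clear PA; have [cpq|cpq] := leP (c * p1) q1; [left|right]; split; lra.
- by rewrite /G !slice01 /c divfK// gt_eqF.
exists c, alpha; split => // e e0; have [a [b [_ _ ? ? [Q0 ?]]]] := small e e0.
by exists a, b; split => //; rewrite -fine_prob_gt0.
Qed.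

End slices.

(** * Random variables modulo null sets *)

Section L0_lemmas.
Context d (T : measurableType d) (R : realType) (P : probability T R).

Lemma L0_of (f : T -> R) : measurable_fun setT f ->
  exists X : L0 P, {ae P, forall t, X t = f t}.
Proof.
move=> mf; exists (L0_class P (mfun_Sub (mem_set mf))).
by apply: filterS (L0_classP P (mfun_Sub (mem_set mf))) => t /(_ I).
Qed.

Lemma L0_conv (l : {i01 R}) (X Y : convex_lmodType (L0 P)) :
  {ae P, forall t, (conv l X Y : L0 P) t =
    l%:num * (X : L0 P) t + (1 - l%:num) * (Y : L0 P) t}.
Proof.
have := L0D (l%:num *: (X : L0 P)) ((1 - l%:num) *: (Y : L0 P)).
apply: filterS3 (L0Z l%:num (X : L0 P)) (L0Z (1 - l%:num) (Y : L0 P)).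
by move=> t /(_ I) <- /(_ I) <- /(_ I).
Qed.

(** Translation invariance, which brings balls about [X] into the form X + U used in the definition
    of local convexity. *)
Lemma L0_ball_sub0 (X Y : L0 P) (e : R) : L0_ball X e Y -> L0_ball 0 e (Y - X).
Proof.
rewrite /L0_ball; apply: le_lt_trans.
apply: ae_le_measure; [exact: measurable_deviation..|].
apply: filterS3 (L0N X) (L0D Y (- X)) (L00 P) => t.
move=> /(_ I) hN /(_ I) hD /(_ I) h0; rewrite /deviation/=.
by rewrite hD hN h0 sub0r opprB.
Qed.

End L0_lemmas.

(** * Pointwise inequalities between real numbers *)

Lemma convex_comb_lt (R : realFieldType) (x a b r : R) :
  0 <= x -> x <= 1 -> a < r -> b < r -> x * a + (1 - x) * b < r.
Proof. by move=> x0 x1 ar br; have [ab|/ltW ab] := leP a b; nra. Qed.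

(* In both bounds D marks the exceptional event |Y - X| >= e.  The part of
   v |y - x| that is not small is v y - v x, whose integral only involves
   moments. *)
Lemma base_dist_bound (R : realFieldType) (v x y e : R) (D : bool) :
  0 <= v <= 1 -> 0 <= x -> 0 <= y -> 0 < e -> D \/ `|y - x| < e ->
  v * `|y - x| <= v * y - v * x + 2 * (D%:R * x) + D%:R + 2 * e.
Proof.
move=> /andP[v0 v1] x0 y0 e0.
have vx : v * x <= x by rewrite ler_piMl.
have vy : 0 <= v * y by rewrite mulr_ge0.
(* For y < x the distance v (x - y) exceeds v y - v x by 2 v (x - y), which is at most 2 x on the
   exceptional event and at most 2 e off it. *)
have [xy|yx] := leP x y.
  by rewrite ger0_norm ?subr_ge0//; case: D => _ /=; lra.
have vxy : v * (x - y) <= x - y by rewrite ler_piMl// subr_ge0 ltW.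
rewrite ltr0_norm ?subr_lt0//; case: D => [_|[//|yxe]] /=; lra.
Qed.

Lemma off_base_dist_bound (R : realFieldType) (x y e : R) (D : bool) :
  0 <= x <= 1 -> 0 <= y <= 1 -> 0 < e -> D \/ `|y - x| < e ->
  `|y - x| <= 2 * (D%:R * x) + D%:R + 2 * e.
Proof.
move=> /andP[x0 x1] /andP[y0 y1] e0.
case: D => [_|[//|yxe]] /=; last by lra.
by rewrite (@le_trans _ _ 1)// ?ler_norml; lra.
Qed.

(** * The set of encoded subprobabilities *)

Section moments.
Context d (T : measurableType d) (R : realType) (P : probability T R).
Variables (u : T -> R) (k : T -> nat).
Hypothesis measurable_u : measurable_fun setT u.
Hypothesis u01 : forall t, 0 <= u t < 1.
Hypothesis measurable_k : measurable_fun setT k.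
Hypothesis diffuse : forall a, P [set t | u t = a] = 0%E.
Hypothesis k_gt0 : forall j, (0 < P (k @^-1` [set j]))%E.
Local Notation integrable f := (P.-integrable setT (EFin \o f)).

Let u01W t : 0 <= u t <= 1.
Proof. by have /andP[-> /ltW->] := u01 t. Qed.

(** * Polynomials integrated against coded subprobabilities *)

Definition base : set T := k @^-1` [set 0%N].

Lemma measurable_base : measurable base.
Proof. by rewrite -[X in measurable X]setTI; exact: measurable_k. Qed.
Local Hint Resolve measurable_base : core.

Lemma indic_baseE t : \1_base t = (k t == 0%N)%:R :> R.
Proof.
rewrite indicE; congr (_ %:R : R); congr nat_of_bool.
by apply/idP/eqP => [/set_mem|kt]; [|apply/mem_set].
Qed.

Definition weight (p : {poly R}) (t : T) : R := \1_base t * p.[u t].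

Lemma weightE p t : weight p t = if k t == 0%N then p.[u t] else 0.
Proof. by rewrite /weight indic_baseE; case: ifP; rewrite ?mul1r ?mul0r. Qed.

Lemma measurable_weight p : measurable_fun setT (weight p).
Proof.
apply: measurable_funM; first exact: measurable_indic.
by apply: measurableT_comp; first exact: measurable_poly.
Qed.

Local Hint Resolve measurable_weight : core.

Lemma horner_bounded (p : {poly R}) :
  exists c, forall x : R, 0 <= x <= 1 -> `|p.[x]| <= c.
Proof.
exists (\sum_(i < size p) `|p`_i|) => x /andP[x0 x1].
rewrite horner_coef (le_trans (ler_norm_sum _ _ _))// ler_sum// => i _.
by rewrite normrM ler_piMr// normrX exprn_ile1// ger0_norm.
Qed.

Lemma weight_bounded p : exists c, forall t, `|weight p t| <= c.
Proof.
have [c pc] := horner_bounded p; exists c => t.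
have c0 : 0 <= c by rewrite (le_trans _ (pc 0 _)) ?lexx ?ler01.
rewrite weightE; case: ifP => _; rewrite ?normr0//.
exact: pc.
Qed.

Lemma integrable_weight p (f : T -> R) : integrable f ->
  integrable (fun t => weight p t * f t).
Proof.
have [c pc] := weight_bounded p.
by apply: integrable_bounded_mul pc; exact: measurable_weight.
Qed.

(* The integral of p against the sum of the finitely supported measure coded
   by s (a list of pairs (mass, position)) and of the image under u of the
   density f on the base. *)
Definition mom (f : T -> R) (s : seq (R * R)) (p : {poly R}) : R :=
  \sum_(w <- s) w.1 * p.[w.2] + \int[P]_t (weight p t * f t).

Definition valid_atoms (s : seq (R * R)) :=
  all (fun w => (0 <= w.1) && (0 <= w.2 <= 1)) s.

Lemma momD f s p q : integrable f -> mom f s (p + q) = mom f s p + mom f s q.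
Proof.
move=> fi; rewrite /mom addrACA -big_split/=; congr (_ + _).
  by apply: eq_bigr => w _; rewrite hornerD mulrDr.
rewrite -RintegralD//; [|exact: integrable_weight..].
by apply: eq_Rintegral => t _; rewrite /weight hornerD mulrDr mulrDl.
Qed.

Lemma momZ f s c p : integrable f -> mom f s (c *: p) = c * mom f s p.
Proof.
move=> fi; rewrite /mom mulrDr mulr_sumr; congr (_ + _).
  by apply: eq_bigr => w _; rewrite hornerZ mulrCA.
rewrite -(RintegralZl _ _ (integrable_weight p fi))//.
by apply: eq_Rintegral => t _; rewrite /weight hornerZ; ring.
Qed.

(* The factor 1 / (j + 1) makes phi j 1-Lipschitz on [0, 1]. *)
Definition phi j : {poly R} := j.+1%:R^-1 *: 'X^j.

(** Linearity in the polynomial, where [j.+1] undoes the normalisation of [phi j]. Control of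
    finitely many coordinates off the base thus controls the integral of any fixed polynomial. *)
Lemma mom_phi f s p : integrable f ->
  mom f s p = \sum_(j < size p) p`_j * j.+1%:R * mom f s (phi j).
Proof.
move=> fi; rewrite -[in LHS](coefK p) poly_def.
rewrite (big_morph (mom f s) (id1 := 0) (op1 := +%R)).
- by apply: eq_bigr => j _; rewrite !momZ// mulrA mulfK.
- by move=> p1 p2; exact: momD.
- by rewrite -(scale0r 0) momZ// mul0r.
Qed.

Lemma phi_lipschitz j (x y : R) : 0 <= x <= 1 -> 0 <= y <= 1 ->
  `|(phi j).[x] - (phi j).[y]| <= `|x - y|.
Proof.
move=> /andP[x0 x1] /andP[y0 y1].
have step : `|x ^+ j - y ^+ j| <= j%:R * `|x - y|.
  elim: j => [|j ih]; first by rewrite !expr0 subrr normr0 mul0r.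
  have -> : x ^+ j.+1 - y ^+ j.+1 = x * (x ^+ j - y ^+ j) + (x - y) * y ^+ j.
    by rewrite !exprS; ring.
  rewrite (le_trans (ler_normD _ _))//.
  have -> : j.+1%:R * `|x - y| = j%:R * `|x - y| + `|x - y|.
    by rewrite -natr1 mulrDl mul1r.
  apply: lerD; rewrite normrM.
    by rewrite (le_trans _ ih)// ler_piMl// ger0_norm.
  by rewrite ler_piMr// ger0_norm ?exprn_ge0// exprn_ile1.
rewrite !hornerZ !hornerXn -mulrBr normrM ger0_norm// mulrC ler_pdivrMr//.
by rewrite (le_trans step)// mulrC ler_wpM2l// ler_nat.
Qed.

Lemma phi_ge0_le1 j (x : R) : 0 <= x <= 1 -> 0 <= (phi j).[x] <= 1.
Proof.
move=> /andP[x0 x1]; rewrite hornerZ hornerXn mulr_ge0 ?exprn_ge0//=.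
by rewrite mulrC ler_pdivrMr// mul1r (le_trans (exprn_ile1 _ _ _))// ler1n.
Qed.

Lemma le_mom f s p q : integrable f -> valid_atoms s ->
  {ae P, forall t, 0 <= f t} ->
  (forall x, 0 <= x <= 1 -> p.[x] <= q.[x]) -> mom f s p <= mom f s q.
Proof.
move=> fi /allP sgood f0 pq; apply: lerD.
  rewrite big_seq [leRHS]big_seq ler_sum// => w /sgood/andP[w0 w01].
  by rewrite ler_wpM2l// pq.
apply: ae_le_Rintegral; [exact: integrable_weight..|].
apply: filterS f0 => t f0; rewrite ler_wpM2r// !weightE; case: ifP => // _.
exact: pq.
Qed.

Lemma mom_ae f g s p : measurable_fun setT f -> measurable_fun setT g ->
  {ae P, forall t, f t = g t} -> mom f s p = mom g s p.
Proof.
move=> mf mg fg; congr (_ + _); apply: ae_eq_Rintegral.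
- by apply: measurable_funM => //; exact: measurable_weight.
- by apply: measurable_funM => //; exact: measurable_weight.
- by apply: filterS fg => t ->.
Qed.

(** Positions may repeat in a list of atoms, so mixing two atomic parts is rescaling and
    concatenation. *)
Definition mix_atoms (l : R) (s1 s2 : seq (R * R)) :=
  [seq (l * w.1, w.2) | w <- s1] ++ [seq ((1 - l) * w.1, w.2) | w <- s2].

Lemma mom_mix_atoms l f g s1 s2 p : integrable f -> integrable g ->
  mom (fun t => l * f t + (1 - l) * g t) (mix_atoms l s1 s2) p =
  l * mom f s1 p + (1 - l) * mom g s2 p.
Proof.
move=> fi gi; rewrite /mom big_cat !big_map !mulrDr addrACA; congr (_ + _).
  by rewrite !mulr_sumr; congr (_ + _); apply: eq_bigr => w _; rewrite mulrA.
have iw h : integrable h -> integrable (fun t => weight p t * h t).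
  exact: integrable_weight.
rewrite -(RintegralZl _ _ (iw _ fi))// -(RintegralZl _ _ (iw _ gi))//.
rewrite -RintegralD//; [|exact/Rintegrable_scale/iw..].
by apply: eq_Rintegral => t _; ring.
Qed.

Lemma valid_mix_atoms l s1 s2 : 0 <= l <= 1 ->
  valid_atoms s1 -> valid_atoms s2 -> valid_atoms (mix_atoms l s1 s2).
Proof.
move=> /andP[l0 l1] /allP g1 /allP g2; apply/allP => w.
rewrite mem_cat => /orP[] /mapP[v vs ->] /=.
  by have /andP[v0 ->] := g1 _ vs; rewrite andbT mulr_ge0.
by have /andP[v0 ->] := g2 _ vs; rewrite andbT mulr_ge0// subr_ge0.
Qed.

(* On the base X is the density, and off the base X lists the normalised
   moments, of one and the same subprobability with atoms s. *)
Definition codes (X : L0 P) (s : seq (R * R)) :=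
  [/\ valid_atoms s, mom X s 1 <= 1 &
      {ae P, forall t j, k t = j.+1 -> X t = mom X s (phi j)}].

Definition momentset : set (L0 P) :=
  [set X : L0 P | [/\ integrable (X : T -> R), {ae P, forall t, 0 <= X t} &
               exists s, codes X s]].

Lemma mom_phi_ge0_le1 f s j : integrable f -> valid_atoms s ->
  {ae P, forall t, 0 <= f t} -> mom f s 1 <= 1 -> 0 <= mom f s (phi j) <= 1.
Proof.
move=> fi gs f0 f1; apply/andP; split.
  rewrite -[leLHS](_ : mom f s 0 = 0); last first.
    by rewrite -(scale0r 0) momZ// mul0r.
  by apply: le_mom => // x /(phi_ge0_le1 j)/andP[]; rewrite horner0.
rewrite (le_trans _ f1)//; apply: le_mom => // x /(phi_ge0_le1 j)/andP[].
by rewrite hornerC.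
Qed.

Lemma momentset_off_base X : momentset X ->
  {ae P, forall t, k t != 0%N -> 0 <= X t <= 1}.
Proof.
move=> [Xi X0 [s [gs X1 Xphi]]]; apply: filterS Xphi => t.
case: (k t) => // j /(_ j erefl) -> _.
exact: mom_phi_ge0_le1.
Qed.

(** Moments are affine in the pair of density and atoms, so the mixture of two codes is the code of
    the mixed subprobability. *)
Lemma momentset_convex : convex_set (momentset : set (convex_lmodType (L0 P))).
Proof.
move=> X Y l; rewrite !inE.
move=> [Xi X0 [s [gs X1 Xphi]]] [Yi Y0 [r [gr Y1 Yphi]]].
have cE := L0_conv l X Y; set Z : L0 P := conv l X Y.
have l01 : 0 <= l%:num <= 1 by apply/andP; split.
have /andP[l0 l1] := l01.
pose h t := l%:num * (X : L0 P) t + (1 - l%:num) * (Y : L0 P) t.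
have hi : integrable h by apply: Rintegrable_add; exact: Rintegrable_scale.
have mZ : measurable_fun setT Z by [].
have mh := integrable_measurable hi.
have momZE p : mom Z (mix_atoms l%:num s r) p =
    l%:num * mom (X : L0 P) s p + (1 - l%:num) * mom (Y : L0 P) r p.
  by rewrite -mom_mix_atoms//; exact: mom_ae.
split.
- by apply: ae_eq_integrable hi mZ _; apply: filterS cE => t ->.
- apply: filterS3 cE X0 Y0 => t -> x0 y0.
  by rewrite addr_ge0// mulr_ge0// subr_ge0.
- exists (mix_atoms l%:num s r); split; first exact: valid_mix_atoms.
    rewrite momZE (@le_trans _ _ (l%:num * 1 + (1 - l%:num) * 1)) ?lerD//.
    + by rewrite ler_wpM2l.
    + by rewrite ler_wpM2l// subr_ge0.
    + by lra.
  apply: filterS3 cE Xphi Yphi => t -> xj yj j kt.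
  by rewrite momZE (xj j kt) (yj j kt).
Qed.

Lemma integral_weight_le_mom (f : T -> R) s p : valid_atoms s ->
  (forall x, 0 <= x <= 1 -> 0 <= p.[x]) ->
  \int[P]_t (weight p t * f t) <= mom f s p.
Proof.
move=> /allP gs p0; rewrite lerDr big_seq sumr_ge0// => w /gs/andP[w0 /p0].
exact: mulr_ge0.
Qed.

(** * Integrability and boundedness of the set *)

Lemma momentset_L1plus : momentset `<=` L1plus P.
Proof. by move=> X [Xi X0 _]; split => //; exact/Lfun1_integrable. Qed.

(** The base contributes at most the total mass 1 of the coded measure. Off the base the values are
    moments in [0, 1], which contribute at most 1 more. *)
Lemma momentset_bounded : L1_bounded momentset.
Proof.
apply: (@le_lt_trans _ _ 2%:E%E); last exact: ltry.
apply: ge_ereal_sup => _ [X KX <-]; rewrite unlock.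
have X01 := momentset_off_base KX.
have [Xi X0 [s [gs X1 _]]] := KX.
have Xni : integrable (fun t => `|X t|) by exact: integrable_norm.
rewrite -[leLHS]fineK ?integrable_fin_num// lee_fin -/(Rintegral _ _ _).
have i1 := integrable_weight 1 Xi.
rewrite (@le_trans _ _ (\int[P]_t (weight 1 t * X t + 1)))//.
  apply: ae_le_Rintegral => //.
    by apply: Rintegrable_add => //; exact: integrable_const.
  apply: filterS2 X0 X01 => t X0 X01.
  rewrite weightE hornerC ger0_norm//; case: ifPn => kt.
    by rewrite mul1r lerDl.
  by rewrite mul0r add0r; have /andP[] := X01 kt.
rewrite RintegralD//; last exact: integrable_const.
rewrite Rintegral_const -[leRHS]/(1 + 1 : R) lerD2r (le_trans _ X1)//.
by apply: integral_weight_le_mom => // x _; rewrite hornerC.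
Qed.

(** * Local convexity through a weighted norm *)

Definition vanishing (s : seq (R * R)) : {poly R} :=
  \prod_(w <- s) ('X - w.2%:P) ^+ 2.

Lemma vanishing_ge0_le1 s x : valid_atoms s -> 0 <= x <= 1 ->
  0 <= (vanishing s).[x] <= 1.
Proof.
move=> /allP gs /andP[x0 x1]; rewrite /vanishing horner_prod big_seq.
apply/andP; split; first by apply: prodr_ge0 => w _; rewrite horner_exp sqr_ge0.
apply: prodr_ile1 => w /gs/andP[_ /andP[w0 w1]].
rewrite horner_exp hornerXsubC sqr_ge0/= -real_normK ?num_real// exprn_ile1//.
by rewrite ler_norml; apply/andP; split; lra.
Qed.

Lemma vanishing_root s w : w \in s -> (vanishing s).[w.2] = 0.
Proof.
move=> ws; apply/eqP; rewrite /vanishing horner_prod prodf_seq_eq0.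
by apply/hasP; exists w => //=; rewrite horner_exp hornerXsubC subrr expr0n.
Qed.

(** The weight of the norm used near a point with atoms [s]. It suppresses the places on the base
    where mass may concentrate into an atom, and changes nothing off the base. *)
Definition damping s t : R := weight (vanishing s) t + \1_(~` base) t.

Lemma dampingE s t :
  damping s t = if k t == 0%N then (vanishing s).[u t] else 1.
Proof.
rewrite /damping weightE indicE in_setC.
have -> : (t \in base) = (k t == 0%N).
  by apply/idP/eqP => [/set_mem|kt]; [|apply/mem_set].
by case: ifP => _; rewrite ?addr0 ?add0r.
Qed.

Lemma measurable_damping s : measurable_fun setT (damping s).
Proof.
apply: measurable_funD => //; apply: measurable_indic.
exact: measurableC.
Qed.

Lemma damping_ge0_le1 s t : valid_atoms s -> 0 <= damping s t <= 1.
Proof.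
move=> gs; rewrite dampingE; case: ifP => _; last by rewrite ler01 lexx.
exact: vanishing_ge0_le1.
Qed.

(** The zeros lie in finitely many level sets of [u], which are null because [u] is diffuse. Hence
    the weighted norm still detects convergence in probability. *)
Lemma damping_eq0_null s : P [set t | damping s t = 0] = 0%E.
Proof.
have sub : [set t | damping s t = 0] `<=`
    \big[setU/set0]_(w <- s) [set t | u t = w.2].
  move=> t /=; rewrite dampingE; case: ifP => _; last first.
    by move/eqP; rewrite oner_eq0.
  move=> /eqP; rewrite /vanishing horner_prod prodf_seq_eq0 => /hasP[w ws /=].
  rewrite horner_exp hornerXsubC expf_eq0/= subr_eq0 => /eqP utw.
  by rewrite -bigcup_seq; exists w.
have null : P.-negligible (\big[setU/set0]_(w <- s) [set t | u t = w.2]).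
  elim: s {sub} => [|w s ih]; rewrite ?big_nil ?big_cons.
    exact: negligible_set0.
  apply: negligibleU ih; exists [set t | u t = w.2].
  split => //; last exact: diffuse.
  rewrite -[X in measurable X]setTI.
  exact: (measurable_u measurableT (measurable_set1 w.2)).
have m0 : measurable [set t | damping s t = 0].
  rewrite -[X in measurable X]setTI.
  exact: (measurable_damping s measurableT (measurable_set1 0)).
exact: (negligibleP P m0).1 (negligibleS sub null).
Qed.

Lemma integrable_damping s (f : T -> R) : valid_atoms s -> integrable f ->
  integrable (fun t => damping s t * f t).
Proof.
move=> gs; apply: (@integrable_bounded_mul _ _ _ _ _ _ 1).
  exact: measurable_damping.
move=> t; have /andP[? ?] := damping_ge0_le1 t gs.
by rewrite ger0_norm.
Qed.

Definition dist s (X Y : T -> R) : R := \int[P]_t (damping s t * `|Y t - X t|).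

Lemma integrable_dist s (X Y : T -> R) : valid_atoms s -> integrable X ->
  integrable Y -> integrable (fun t => damping s t * `|Y t - X t|).
Proof.
move=> gs Xi Yi; apply: integrable_damping => //.
apply: (@integrable_norm _ _ _ _ _ (fun t => Y t - X t)).
exact: Rintegrable_sub.
Qed.

(** Markov's inequality: a deviation of at least e costs at least r e wherever the damping exceeds
    r, and the event where it does not has probability below e / 2. *)
Lemma dist_controls_ball s (X : L0 P) e :
  valid_atoms s -> integrable X -> 0 < e ->
  exists2 r : R, 0 < r &
    forall Y : L0 P, integrable Y -> dist s X Y < r -> L0_ball X e Y.
Proof.
move=> gs Xi e0; have e20 : 0 < e / 2 by rewrite divr_gt0.
have mdens := measurable_damping s.
have d0 := damping_eq0_null s.
have [r r0 Nsmall] := small_ball mdens d0 e20.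
set N := [set t | _] in Nsmall.
have mN : measurable N by exact: measurable_near.
have re0 : 0 < r * e by rewrite mulr_gt0.
exists (r * e * (e / 2)); first by rewrite mulr_gt0.
move=> Y Yi; set D := deviation X Y e.
have mD : measurable D by exact: measurable_deviation.
have mDN : measurable (D `&` ~` N).
  by apply: measurableI => //; exact: measurableC.
have iDN : integrable (\1_(D `&` ~` N) : T -> R) by exact: integrable_indic1.
have : r * e * fine (P (D `&` ~` N)) <= dist s X Y.
  rewrite -Rintegral_indic// -RintegralZl//; apply: le_Rintegral => //.
  - exact: Rintegrable_scale.
  - exact: integrable_dist.
  - move=> t _; have /andP[dt0 dt1] := damping_ge0_le1 t gs.
    rewrite indicE; have [/set_mem[Dt Nt]|_] := boolP (t \in _); last first.
      by rewrite mulr0 mulr_ge0.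
    rewrite mulr1; apply: ler_pM; [exact: ltW|exact: ltW| |by rewrite distrC].
    by move/negP: Nt; rewrite -ltNge subr0 ger0_norm// => /ltW.
move=> /le_lt_trans/[apply]; rewrite ltr_pM2l// => DN.
have Dsub : D `<=` N `|` (D `&` ~` N).
  by move=> t Dt; have [|] := pselect (N t); [left|right].
rewrite /L0_ball (@le_lt_trans _ _ (P N + P (D `&` ~` N))%E)//.
  rewrite (le_trans (le_measure P _ _ Dsub)) ?inE//; first exact: measurableU.
  exact: measureU2.
rewrite [e]splitr EFinD lteD//.
by rewrite -(fineK (fin_num_measure P _ mDN)) lte_fin.
Qed.

(** Almost everywhere on [k = j.+1] both variables are constant, equal to their moments. If these
    were e apart, the whole event would lie in a deviation whose probability is too small to contain
    it. *)
Lemma mom_phi_close (X Y : L0 P) s r j e : codes X s -> codes Y r ->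
  (e%:E <= P (k @^-1` [set j.+1]))%E -> L0_ball X e Y ->
  `|mom Y r (phi j) - mom X s (phi j)| < e.
Proof.
move=> [_ _ Xj] [_ _ Yj] ej XY; rewrite ltNge; apply/negP => far.
have mk : measurable (k @^-1` [set j.+1]).
  by rewrite -[X in measurable X]setTI; exact: measurable_k.
suff : (P (k @^-1` [set j.+1]) < e%:E)%E by rewrite ltNge ej.
apply: le_lt_trans XY; apply: ae_le_measure => //.
  exact: measurable_deviation.
apply: filterS2 Xj Yj => t Xj Yj kt; rewrite /deviation/=.
by rewrite (Xj j kt) (Yj j kt) distrC.
Qed.

(** The converse of [dist_controls_ball] within the set. Only the atoms of the centre [X] enter the
    weight; the atoms of [Y] are arbitrary. *)
Lemma ball_controls_dist (X : L0 P) s r : momentset X -> codes X s -> 0 < r ->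
  exists2 e : R, 0 < e &
    forall Y : L0 P, momentset Y -> L0_ball X e Y -> dist s X Y < r.
Proof.
move=> KX Xs r0; have [Xi X0 _] := KX; have [gs X1 Xj] := Xs.
set w := vanishing s; have r40 : 0 < r / 4 by rewrite divr_gt0.
(* Absolute continuity of the integral: [X] integrates to less than r / 4 over every event of
   probability below c. *)
have [c [c0 Xc]] := @integral_normr_continuous _ _ _ P X Xi (r / 4) r40.
pose C : R := \sum_(j < size w) `|w`_j| * j.+1%:R.
have C0 : 0 <= C by apply: sumr_ge0 => j _; rewrite mulr_ge0.
pose q j := fine (P (k @^-1` [set j])).
have mk j : measurable (k @^-1` [set j]).
  by rewrite -[X in measurable X]setTI; exact: measurable_k.
(* [mom_phi_close] needs e to be at most the probability of each event that carries a moment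
   entering the polynomial; there are finitely many of them. *)
have [e0 e00 e0q] : exists2 e0, 0 < e0 &
    forall j, (j < size w)%N -> e0 <= q j.+1.
  elim: (size w) => [|n [e0 e00 e0q]]; first by exists 1.
  exists (Num.min e0 (q n.+1)).
    by rewrite lt_min e00 /q fine_prob_gt0 ?k_gt0.
  move=> j; rewrite ltnS leq_eqVlt => /predU1P[->|/e0q jq].
    by rewrite ge_min lexx orbT.
  by rewrite ge_min jq.
have C40 : 0 < C + 4 by lra.
(* Error budget: the moments contribute at most C e, [X] on the exceptional event less than 2 (r /
   4), and the probability of that event together with the constant 2 e less than 3 e. The total
   stays below r. *)
pose e := Num.min e0 (Num.min c (r / 4 / (C + 4))).
have e_gt0 : 0 < e by rewrite !lt_min e00 c0 !divr_gt0.
have ee0 : e <= e0 by rewrite ge_min lexx.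
have ec : e <= c by rewrite !ge_min lexx orbT.
have eC : (C + 4) * e <= r / 4.
  by rewrite mulrC -ler_pdivlMr// !ge_min lexx !orbT.
exists e => // Y KY XY; have [Yi Y0 [s' Ys']] := KY.
have [gs' Y1 Yj] := Ys'.
set D := deviation X Y e.
have mD : measurable D by exact: measurable_deviation.
have PD : fine (P D) < e.
  by rewrite -lte_fin fineK// fin_num_measure.
have XD : \int[P]_t (\1_D t * X t) < r / 4.
  have /(Xc _ mD) : (P D < c%:E)%E by rewrite (lt_le_trans XY)// lee_fin.
  apply: le_lt_trans; rewrite (Rintegral_mkcond P D); apply: le_Rintegral => //.
  - exact: integrable_indic_mul.
  - apply: (@eq_integrable _ _ _ P _ measurableT
      (EFin \o (fun t => \1_D t * `|X t|))).
      move=> t _ /=; rewrite patchE indicE.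
      by case: ifP => _; rewrite ?mul1r ?mul0r.
    by apply: integrable_indic_mul => //; exact: integrable_norm.
  - move=> t _; rewrite patchE indicE; case: ifP => _; rewrite ?mul1r ?mul0r//.
    exact: ler_norm.
have Lw : mom Y s' w - mom X s w <= C * e.
  rewrite (mom_phi _ w Yi) (mom_phi _ w Xi).
  rewrite -sumrB /C mulr_suml ler_sum// => j _.
  rewrite -mulrBr (le_trans (ler_norm _))// normrM normrM.
  rewrite (ger0_norm (ler0n _ _)) ler_wpM2l ?mulr_ge0//.
  apply/ltW/mom_phi_close => //.
  rewrite -[leRHS]fineK ?fin_num_measure// lee_fin.
  exact: le_trans ee0 (e0q _ _).
(* The atoms of [X] sit at roots of [w]. Those of [Y] need not, but their contribution is
   nonnegative, which suffices for the one-sided bound [Ly]. *)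
have Lx : mom X s w = \int[P]_t (weight w t * X t).
  rewrite /mom big_seq big1 ?add0r// => v vs.
  by rewrite vanishing_root// mulr0.
have Ly : \int[P]_t (weight w t * Y t) <= mom Y s' w.
  by apply: integral_weight_le_mom => // x /(vanishing_ge0_le1 gs)/andP[].
have X01 := momentset_off_base KX.
have Y01 := momentset_off_base KY.
have wY := integrable_weight w Yi; have wX := integrable_weight w Xi.
have i1D : integrable (\1_D : T -> R) by exact: integrable_indic1.
have i1DX : integrable (fun t => \1_D t * X t) by exact: integrable_indic_mul.
have i2 : integrable (fun t => 2 * (\1_D t * X t)) by exact: Rintegrable_scale.
have ie : integrable (fun=> 2 * e) by exact: integrable_const.
have iwYX := Rintegrable_sub wY wX.
have i3 := Rintegrable_add iwYX i2.
have i4 := Rintegrable_add i3 i1D.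
have i5 := Rintegrable_add i4 ie.
(* By Lx and Ly, w integrates the density of X to its full moment but that of Y
   to at most its moment, so E[w(u) (Y - X)] is at most a difference of moments. *)
suff : dist s X Y <= \int[P]_t ((((weight w t * Y t - weight w t * X t) +
    2 * (\1_D t * X t)) + \1_D t) + 2 * e).
  rewrite (RintegralD _ i4 ie)// (RintegralD _ i3 i1D)//.
  rewrite (RintegralD _ iwYX i2)// (RintegralB _ wY wX)// RintegralZl//.
  rewrite Rintegral_const Rintegral_indic// -Lx => /le_lt_trans; apply.
  by move: PD XD Lw Ly eC; move: (\int[P]_t _) (fine _) => ? ?; lra.
apply: ae_le_Rintegral => //; first exact: integrable_dist.
apply: filterS3 X0 Y0 (filterI X01 Y01) => t X0t Y0t [X01t Y01t].
rewrite dampingE weightE indicE.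
have XYt : t \in D \/ `|Y t - X t| < e.
  have [tD|tD] := boolP (t \in D); [by left|right].
  by rewrite ltNge distrC; apply/negP => /mem_set; apply/negP.
case: ifPn => [kt|kt].
  by apply: base_dist_bound => //; exact: vanishing_ge0_le1.
rewrite !mul0r subrr add0r mul1r.
by apply: off_base_dist_bound => //; [exact: X01t|exact: Y01t].
Qed.

(** The convex neighbourhood is the trace on the set of a ball about [X] in the weighted norm.
    [ball_controls_dist] makes it a neighbourhood, and [dist_controls_ball] fits it into X + U. *)
Lemma momentset_locally_convex : L0_locally_convex momentset.
Proof.
move=> X KX U /nbhs_ballP[e /= e0 eU].
have [Xi X0 [s Xs]] := KX; have [gs _ _] := Xs.
have [r r0 rball] := dist_controls_ball gs Xi e0.
have [e' e'0 balle'] := ball_controls_dist KX Xs r0.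
exists [set Y | momentset Y /\ dist s X Y < r]; split.
- rewrite /within/=; apply/nbhs_ballP; exists e' => // Y XY KY; split => //.
  exact: balle'.
- move=> Y Z l; rewrite !inE => -[KY Yr] [KZ Zr].
  have [Yi _ _] := KY; have [Zi _ _] := KZ.
  have KW : momentset (conv l Y Z).
    apply/set_mem; apply: momentset_convex => //; exact: mem_set.
  split => //; have [Wi _ _] := KW.
  have iY := integrable_dist gs Xi Yi; have iZ := integrable_dist gs Xi Zi.
  have l0 : 0 <= l%:num by []. have l1 : l%:num <= 1 by [].
  have le_conv : dist s X (conv l Y Z : L0 P) <=
      l%:num * dist s X (Y : L0 P) + (1 - l%:num) * dist s X (Z : L0 P).
    rewrite -!RintegralZl// -RintegralD//; [|exact: Rintegrable_scale..].
    apply: ae_le_Rintegral; first exact: integrable_dist.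
      by apply: Rintegrable_add; exact: Rintegrable_scale.
    apply: filterS (L0_conv l Y Z) => t ->.
    have /andP[d0 _] := damping_ge0_le1 t gs.
    rewrite [X in _ <= X](_ : _ = damping s t *
      (l%:num * `|(Y : L0 P) t - X t| + (1 - l%:num) * `|(Z : L0 P) t - X t|));
      last by ring.
    rewrite ler_wpM2l//.
    rewrite (_ : _ - X t = l%:num * ((Y : L0 P) t - X t) +
      (1 - l%:num) * ((Z : L0 P) t - X t)); last by ring.
    rewrite (le_trans (ler_normD _ _))//.
    by rewrite !normrM (ger0_norm l0) (@ger0_norm _ (1 - _)) ?subr_ge0.
  exact: le_lt_trans le_conv (convex_comb_lt l0 l1 Yr Zr).
- move=> Y [KY Yr]; split => //; have [Yi _ _] := KY.
  exists (Y - X); last by rewrite addrC subrK.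
  by apply: eU; apply: L0_ball_sub0; exact: rball.
Qed.

(** * Points of the set with prescribed density and atoms *)

Definition encode (f : T -> R) (s : seq (R * R)) (t : T) : R :=
  \1_base t * f t + (if k t is j.+1 then mom f s (phi j) else 0).

Lemma measurable_encode f s : measurable_fun setT f ->
  measurable_fun setT (encode f s).
Proof.
move=> mf; apply: measurable_funD.
  by apply: measurable_funM => //; exact: measurable_indic.
pose M (n : nat) : R := if n is j.+1 then mom f s (phi j) else 0.
have mM : measurable_fun setT M by [].
exact: measurableT_comp mM measurable_k.
Qed.

(** Polynomial weights vanish off the base, so overwriting [f] there leaves all moments unchanged.
    The values written off the base are therefore the moments of the coded variable itself. *)
Lemma encode_mem (f : T -> R) s : integrable f -> (forall t, 0 <= f t) ->
  valid_atoms s -> mom f s 1 <= 1 ->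
  exists2 X : L0 P, momentset X & {ae P, forall t, X t = encode f s t}.
Proof.
move=> fi f0 gs f1; have mf := integrable_measurable fi.
have f0ae : {ae P, forall t, 0 <= f t} by exact: nearW.
have phi01 j := mom_phi_ge0_le1 j fi gs f0ae f1.
have menc := measurable_encode s mf.
have enc0 t : 0 <= encode f s t.
  rewrite addr_ge0 ?mulr_ge0//; case: (k t) => // j.
  by have /andP[] := phi01 j.
have [X XE] := L0_of P menc; exists X => //.
have momE p : mom X s p = mom f s p.
  congr (_ + _); apply: ae_eq_Rintegral.
  - exact: measurable_funM.
  - exact: measurable_funM.
  - apply: filterS XE => t ->; rewrite /encode indic_baseE weightE.
    by case: (k t) => [|j] /=; rewrite ?mul0r// mul1r addr0.
split.
- apply: ae_eq_integrable (_ : integrable (encode f s)) _ _ => //; last first.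
    by apply: filterS XE => t ->.
  (* The summand 1 dominates the moments written off the base. *)
  apply: (@le_integrable _ _ _ P setT _ _ (EFin \o (fun t => f t + 1))) => //.
  + exact/measurable_EFinP.
  + move=> t _; rewrite /= lee_fin (ger0_norm (enc0 t)) ger0_norm ?addr_ge0//.
    apply: lerD; last by case: (k t) => // j; have /andP[] := phi01 j.
    by rewrite indicE ler_piMl//; case: (_ \in _).
  + exact: Rintegrable_add fi (integrable_const P 1).
- by apply: filterS XE => t ->.
- exists s; split => //; first by rewrite momE.
  apply: filterS XE => t -> j kt.
  by rewrite momE /encode indic_baseE kt mul0r add0r.
Qed.

Lemma mom_atom (a : R) p : mom (fun=> 0) [:: (1, a)] p = p.[a].
Proof.
rewrite /mom big_seq1 mul1r (_ : \int[P]_t _ = 0) ?addr0//.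
by under eq_Rintegral do rewrite mulr0; rewrite Rintegral_const.
Qed.

(** * Densities close to a Dirac mass, and the failure for every equivalent measure *)

Definition bump (J : set T) (t : T) : R := (fine (P J))^-1 * \1_J t.

Lemma integrable_bump J : measurable J -> integrable (bump J).
Proof. by move=> mJ; apply: Rintegrable_scale; exact: integrable_indic1. Qed.

Lemma Rintegral_bump J : measurable J -> (0 < P J)%E ->
  \int[P]_t bump J t = 1.
Proof.
move=> mJ PJ; rewrite RintegralZl//; last exact: integrable_indic1.
by rewrite Rintegral_indic// mulVf// gt_eqF// fine_prob_gt0.
Qed.

(** The bump is a probability density living where [u] is within r of a, and [phi j] is 1-Lipschitz.
    The bound is uniform in j, so a single event [J] handles all coordinates at once. *)
Lemma mom_bump J a r j : measurable J -> (0 < P J)%E -> 0 <= a <= 1 ->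
  J `<=` base `&` [set t | `|u t - a| <= r] ->
  `|mom (bump J) [::] (phi j) - (phi j).[a]| <= r.
Proof.
move=> mJ PJ a01 Jsub; have ibump := integrable_bump mJ.
rewrite /mom big_nil add0r.
have -> : (phi j).[a] = \int[P]_t ((phi j).[a] * bump J t).
  by rewrite RintegralZl// Rintegral_bump// mulr1.
have iw := integrable_weight (phi j) ibump.
have ic := Rintegrable_scale (phi j).[a] ibump.
rewrite -(RintegralB _ iw ic)//.
rewrite (le_trans (le_normr_Rintegral _ (Rintegrable_sub iw ic)))//.
rewrite -[leRHS]mulr1 -(Rintegral_bump mJ PJ) -RintegralZl//.
apply: le_Rintegral => //.
- by apply: integrable_norm; exact: Rintegrable_sub.
- exact: Rintegrable_scale.
- move=> t _; rewrite -mulrBl normrM /bump indicE.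
  have [/set_mem/Jsub[kt ut]|_] := boolP (t \in J); last first.
    by rewrite !mulr0 normr0 mulr0.
  rewrite mulr1 [`|_^-1|]ger0_norm ?invr_ge0 ?fine_ge0//.
  rewrite ler_wpM2r ?invr_ge0 ?fine_ge0//.
  rewrite weightE (_ : k t = 0%N)//= (le_trans _ ut)//.
  exact: phi_lipschitz.
Qed.

Lemma mom_bump1 J : measurable J -> (0 < P J)%E -> J `<=` base ->
  mom (bump J) [::] 1 = 1.
Proof.
move=> mJ PJ Jb; rewrite /mom big_nil add0r -(Rintegral_bump mJ PJ).
apply: eq_Rintegral => t _; rewrite weightE /bump indicE hornerC.
have [/set_mem/Jb kt|_] := boolP (t \in J); last by rewrite !mulr0.
by rewrite (_ : k t = 0%N)// mul1r.
Qed.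

Lemma L0_transportE (Q : probability T R) (X : L0 P) (f : T -> R) : Q `<< P ->
  {ae P, forall t, X t = f t} -> {ae Q, forall t, L0_transport Q X t = f t}.
Proof.
move=> QP /(dominates_ae QP); apply: filterS2 (L0_classP Q X) => t.
by move=> /(_ I) <-.
Qed.

Lemma topologies_disagree (Q : probability T R) : equivalent_measure Q P ->
  ~ L0_L1_topologies_agree (L0_transport Q @` momentset).
Proof.
move=> [QP PQ] [KL1 agree]; set KQ := L0_transport Q @` momentset in KL1 agree.
have [c [a [c0 a01 small]]] :=
  nested_slices measurable_u u01 PQ measurable_base (k_gt0 0).
have Qdiffuse x : Q [set t | u t = x] = 0%E.
  move/null_content_dominatesP : QP; apply; last exact: diffuse.
  rewrite -[X in measurable X]setTI.
  exact: (measurable_u measurableT (measurable_set1 x)).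
have gooda : valid_atoms [:: (1, a)] by rewrite /valid_atoms/= ler01 a01.
(* The Dirac mass at a: one atom and zero density, so its code vanishes on the base. *)
have [||//||X KX XE] := @encode_mem (fun=> 0) [:: (1, a)].
- exact: integrable_const.
- by [].
- by rewrite mom_atom hornerC.
have XQ := L0_transportE QP XE; set X' := L0_transport Q X in XQ.
have KX' : KQ X' by exists X.
have X'L1 : X' \in @L1_pred _ _ _ Q by rewrite inE; exact: KL1.
pose x : L1 Q := MkL1 X'L1.
(* If the topologies agreed, the trace of the norm ball of radius c would be the trace of some open
   [O] of L0. The rest produces a point of [O] outside that ball. *)
have [_ /(_ _)/cid2] := agree (KQ `&` (@L1_val _ _ _ Q @` ball x c)).
case; first by exists (ball x c) => //; exact: ball_open.
move=> O oO AO.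
have /nbhs_ballP[r /= r0 rO] : nbhs X' O.
  apply: open_nbhs_nbhs; split => //.
  suff : (KQ `&` O) X' by case.
  by rewrite -AO; split => //; exists x => //; exact: ballxx.
have [e0 e00 Qe0] := small_ball measurable_u (Qdiffuse a) r0.
(* The bound [e0] makes the event [|u - a| <= e] have [Q] probability below r; the bound r / 2 keeps
   every moment within less than r of that of the Dirac mass. *)
pose e := Num.min e0 (r / 2).
have e_gt0 : 0 < e by rewrite lt_min e00 divr_gt0.
have [a' [b' [aab ba QJ cJ]]] := small e e_gt0.
set J := slice u base a' b' in QJ cJ.
have mJ : measurable J by exact: measurable_slice.
have Jsub := slice_near aab (ltW ba) : J `<=` base `&` _.
have PJ : (0 < P J)%E.
  rewrite lt0e measure_ge0 andbT; apply/eqP => PJ0.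
  move/null_content_dominatesP : QP => /(_ _ mJ PJ0) QJ0.
  by rewrite QJ0 ltxx in QJ.
have [||//||Y KY YE] := @encode_mem (bump J) [::].
- exact: integrable_bump.
- by move=> t; rewrite mulr_ge0 ?invr_ge0 ?fine_ge0.
- by rewrite mom_bump1// => t /Jsub[].
have YQ := L0_transportE QP YE; set Y' := L0_transport Q Y in YQ.
have KY' : KQ Y' by exists Y.
have XY : L0_ball X' r Y'.
  apply: le_lt_trans Qe0; apply: ae_le_measure.
  - exact: measurable_deviation.
  - exact: measurable_near.
  (* On the base the two codes differ only on [J], where [u] is close to a. Off the base they differ
     by at most e, which is less than r. *)
  - apply: filterS2 XQ YQ => t XQ YQ; rewrite /deviation/= XQ YQ /encode.
    case kt : (k t) => [|j]; rewrite indic_baseE kt.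
      rewrite !mul1r !addr0 sub0r normrN /bump indicE.
      have [/set_mem/Jsub[_ /= ue] _|_] := boolP (t \in J).
        by rewrite (le_trans ue)// ge_min lexx.
      by rewrite mulr0 normr0 leNgt r0.
    rewrite !mul0r !add0r mom_atom => far.
    have := mom_bump j mJ PJ a01 Jsub; rewrite distrC => /(le_trans far).
    by rewrite le_min => /andP[_]; lra.
have : (KQ `&` O) Y' by split => //; exact: rO.
rewrite -AO => -[_ [y xy yY']].
move: xy; rewrite -ball_normE/= L1_normE Lnorm1 => /lt_geF.
have ixy : Q.-integrable setT (EFin \o (L1_val (x - y) : T -> R)).
  by have := L1_valP (x - y); rewrite inE => /Lfun1_integrable.
suff : c <= \int[Q]_t `|L1_val (x - y) t| by rewrite /Rintegral/= => ->.
(* The bump is normalised by [P], so its [Q] integral is Q(J) / P(J), at least c by the choice of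
   the slice. On [J] the distance between the codes is the bump itself. *)
apply: (@le_trans _ _ (\int[Q]_t bump J t)).
  rewrite RintegralZl//; last exact: integrable_indic1.
  by rewrite Rintegral_indic// mulrC ler_pdivlMr ?fine_prob_gt0.
apply: ae_le_Rintegral.
- by apply: Rintegrable_scale; exact: integrable_indic1.
- exact: integrable_norm.
- have vxy : L1_val (x - y) = X' - Y' by rewrite -yY'.
  rewrite vxy.
  apply: filterS3 (L0D X' (- Y')) (L0N Y') (filterI XQ YQ) => t.
  move=> /(_ I) -> /(_ I) -> [-> ->]; rewrite /bump indicE.
  have [tJ|_] := boolP (t \in J); last by rewrite mulr0.
  have [kt _] := Jsub _ (set_mem tJ).
  rewrite /encode indic_baseE (_ : k t = 0%N)//= !mul1r !addr0 sub0r normrN.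
  by rewrite /bump indicE tJ ler_norm.
Qed.

End moments.

(** * A concrete space *)

Section example_space.
Context (R : realType).

Let P1 : probability (measurableTypeR R) R := uniform_prob (@ltr01 R).
Let P2 : probability nat R := poisson_prob (1 : R) 0.
(** The first factor supplies a diffuse coordinate, and the Poisson law charges every natural
    number. *)
Definition example_prob : probability (measurableTypeR R * nat)%type R :=
  (P1 \x P2)%E.

Lemma example_probE A B : measurable A -> measurable B ->
  example_prob (A `*` B) = (P1 A * P2 B)%E.
Proof. exact: product_measure1E. Qed.

(** A logistic change of variable: it is injective in the first coordinate, so the law stays
    diffuse, and it lies in (0, 1) at every point rather than only almost surely. *)
Definition abscissa (w : measurableTypeR R * nat) : R := (1 + expR w.1)^-1.

Lemma measurable_abscissa : measurable_fun setT abscissa.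
Proof.
have mV : measurable_fun setT (fun x : R => (1 + expR x)^-1).
  apply: continuous_measurable_fun => x; apply: cvgV.
    by rewrite gt_eqF// addr_gt0// expR_gt0.
  by apply: cvgD; [exact: cvg_cst|exact: continuous_expR].
exact: measurableT_comp mV measurable_fst.
Qed.

Lemma abscissa01 w : 0 <= abscissa w < 1.
Proof.
have e0 := expR_gt0 w.1; rewrite /abscissa invr_ge0 ltW ?addr_gt0//=.
by rewrite invf_lt1 ?addr_gt0// ltrDl.
Qed.

Lemma abscissa_diffuse a : example_prob [set w | abscissa w = a] = 0%E.
Proof.
pose S := [set x : measurableTypeR R | (1 + expR x)^-1 = a].
have -> : [set w | abscissa w = a] = S `*` setT.
  by apply/seteqP; split => [w|w []].
have [S0|/set0P[y Sy]] := eqVneq S set0.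
  by rewrite S0 set0X measure0.
have -> : S = [set y].
  apply/seteqP; split => [x|_ ->//]; rewrite /S/= -Sy.
  by move=> /invr_inj/addrI/expR_inj.
rewrite example_probE//.
have /null_content_dominatesP dom := @dominates_uniform_prob R 0 1 ltr01.
have -> : P1 [set y] = 0%E.
  exact: dom (measurable_set1 y) (lebesgue_measure_set1 y).
by rewrite mul0e.
Qed.

Lemma snd_gt0 j : (0 < example_prob (snd @^-1` [set j]))%E.
Proof.
have -> : snd @^-1` [set j] = setT `*` [set j] :> set (measurableTypeR R * nat).
  by apply/seteqP; split => [w|w []].
rewrite example_probE// [X in (X * _)%E]probability_setT mul1e.
rewrite /P2/= /poisson_prob ltr01 esum_set1.
  by rewrite lte_fin /poisson_pmf ltr01 expr1n mul1r mulr_gt0 ?expR_gt0.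
by rewrite lee_fin poisson_pmf_ge0.
Qed.

End example_space.

Lemma diffuse_momentset d (T : measurableType d) (R : realType)
    (P : probability T R) (u : T -> R) (k : T -> nat) :
  measurable_fun setT u -> (forall t, 0 <= u t < 1) ->
  measurable_fun setT k -> (forall a, P [set t | u t = a] = 0%E) ->
  (forall j, (0 < P (k @^-1` [set j]))%E) ->
  let K : set (L0 P) := momentset u k in
  nonatomic P /\
  convex_set (K : set (convex_lmodType (L0 P))) /\
  K `<=` L1plus P /\
  L1_bounded K /\
  L0_locally_convex K /\
  ~ (exists Q : probability T R,
       equivalent_measure Q P /\
       L0_L1_topologies_agree (L0_transport Q @` K)).
Proof.
move=> mu u01 mk diffuse k_gt0.
split; first exact: diffuse_nonatomic mu u01 P diffuse.
split; first exact: momentset_convex.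
split; first exact: momentset_L1plus.
split; first exact: momentset_bounded.
split; first exact: momentset_locally_convex.
move=> [Q [QP]]; exact: (topologies_disagree mu u01 mk diffuse k_gt0 QP).
Qed.

Theorem theorem1p6 (R : realType) :
  exists (d : measure_display) (T : measurableType d) (P : probability T R)
         (K : set (L0 P)),
    nonatomic P /\
    convex_set (K : set (convex_lmodType (L0 P))) /\
    K `<=` L1plus P /\
    L1_bounded K /\
    L0_locally_convex K /\
    ~ (exists Q : probability T R,
         equivalent_measure Q P /\
         L0_L1_topologies_agree (L0_transport Q @` K)).
Proof.
exists _, _, (example_prob R), (momentset (@abscissa R) snd).
apply: diffuse_momentset.
- exact: measurable_abscissa.
- exact: abscissa01.
- exact: measurable_snd.
- exact: abscissa_diffuse.
- exact: snd_gt0.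
Qed.
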